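(* Let $k$ be a commutative ring and let $\mathsf C$ be a $k$-linear Hom-finite abelian length category. Let $\chi,\psi$ be irreducible characters for $\mathsf C$. Then $$\mathsf{sub}\,\chi=\mathsf{sub}\,\psi\quad\Longleftrightarrow\quad\chi=\psi.$$
   Context: An abelian length category is an abelian category in which every object has finite length. Hom-finite means that each morphism set in $\mathsf C$ has finite length as a $k$-module. $\mathbb N$ contains $0$. For an additive category $\mathsf D$ with cokernels, a character for $\mathsf D$ is a function $\chi\colon \mathrm{Ob}\,\mathsf D\to\mathbb N$ such that (i) $\chi(X\oplus Y)=\chi(X)+\chi(Y)$ for all objects $X,Y$, and (ii) $\chi(X)+\chi(Z)\ge\chi(Y)$ for each exact sequence $X\to Y\to Z\to 0$ in $\mathsf D$ (i.e. $Y\to Z$ is a cokernel of $X\to Y$). A character $\chi\neq 0$ is irreducible if it cannot be written as a sum of two non-zero characters. $\mathsf{Sp}\,\mathsf D$ denotes the set of irreducible characters for $\mathsf D$. For an object $M$ of $\mathsf C$ let $\chi_M(X)=\mathrm{length}_{\mathrm{End}(M)}\mathrm{Hom}(X,M)$. Topology on $\mathsf{Sp}\,\mathsf C$: for a morphism $\alpha\colon X\to Y$ in $\mathsf C$ set $\chi(\alpha)=\chi(X)-\chi(Y)+\chi(\mathrm{Coker}\,\alpha)$; the sets $\mathsf U_\alpha=\{\chi\in\mathsf{Sp}\,\mathsf C\mid\chi(\alpha)\ne 0\}$ form a basis of open sets. A full additive subcategory $\mathsf D\subseteq\mathsf C$ is subobject-closed if each subobject of an object in $\mathsf D$ belongs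 to $\mathsf D$. Then the inclusion $\mathsf D\to\mathsf C$ has a left adjoint $p$ (taking $X$ to $X/U$, where $U\subseteq X$ is the minimal subobject with $X/U\in\mathsf D$), so $\mathsf D$ has cokernels. The map $\mathsf{Sp}\,\mathsf D\to\mathsf{Sp}\,\mathsf C$, $\chi\mapsto\chi\circ p$, identifies $\mathsf{Sp}\,\mathsf D$ with a subset of $\mathsf{Sp}\,\mathsf C$, namely the closure of $\{\chi_M\in\mathsf{Sp}\,\mathsf C\mid M\in\mathsf D\}$. A subset $\mathsf U\subseteq\mathsf{Sp}\,\mathsf C$ is subobject-closed if $\mathsf U=\mathsf{Sp}\,\mathsf D$ for some subobject-closed full additive subcategory $\mathsf D\subseteq\mathsf C$. Intersections of subobject-closed subsets are again subobject-closed. For $\chi\in\mathsf{Sp}\,\mathsf C$, $\mathsf{sub}\,\chi$ is the intersection of all subobject-closed subsets $\mathsf U\subseteq\mathsf{Sp}\,\mathsf C$ with $\chi\in\mathsf U$. *)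

(* Defs.v *)
From mathcomp Require Import all_boot all_algebra.
From mathcomp Require Import boolp classical_sets.

Set Implicit Arguments.
Unset Strict Implicit.
Unset Printing Implicit Defensive.

Import GRing.Theory.
Local Open Scope ring_scope.
Local Open Scope classical_set_scope.

(** ** Linear categories *)

(* [comPzRingType] rather than [comNzRingType]: the zero ring is allowed. *)
Record linCat (k : comPzRingType) : Type := LinCat {
  Ob :> Type;
  Hom : Ob -> Ob -> lmodType k;
  idm : forall X, Hom X X;
  hcomp : forall X Y Z, Hom Y Z -> Hom X Y -> Hom X Z;
  hcompA : forall W X Y Z (h : Hom Y Z) (g : Hom X Y) (f : Hom W X),
    hcomp h (hcomp g f) = hcomp (hcomp h g) f;
  hcomp_idl : forall X Y (f : Hom X Y), hcomp (idm Y) f = f;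
  hcomp_idr : forall X Y (f : Hom X Y), hcomp f (idm X) = f;
  hcomp_linearl : forall X Y Z (f : Hom X Y),
    linear (fun g : Hom Y Z => hcomp g f);
  hcomp_linearr : forall X Y Z (g : Hom Y Z), linear (@hcomp X Y Z g)
}.

Arguments idm {k l} X.
Arguments hcomp {k l X Y Z} g f.
Notation "g \oc f" := (hcomp g f) (at level 40, left associativity).

Section LinearCategory.
Context {k : comPzRingType} {C : linCat k}.

Definition is_zero_object (Z : C) : Prop :=
  (forall X (f g : Hom X Z), f = g) /\ (forall X (f g : Hom Z X), f = g).

Definition is_biproduct (X Y S : C) : Prop :=
  exists (i1 : Hom X S) (i2 : Hom Y S) (p1 : Hom S X) (p2 : Hom S Y),
  [/\ p1 \oc i1 = idm X, p2 \oc i2 = idm Y,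
      p1 \oc i2 = 0, p2 \oc i1 = 0 & i1 \oc p1 + i2 \oc p2 = idm S].

Definition is_mono (X Y : C) (f : Hom X Y) : Prop :=
  forall W (u v : Hom W X), f \oc u = f \oc v -> u = v.

Definition is_epi (X Y : C) (f : Hom X Y) : Prop :=
  forall Z (u v : Hom Y Z), u \oc f = v \oc f -> u = v.

Definition is_iso (X Y : C) (f : Hom X Y) : Prop :=
  exists g : Hom Y X, g \oc f = idm X /\ f \oc g = idm Y.

Definition is_kernel (X Y Z : C) (i : Hom X Y) (f : Hom Y Z) : Prop :=
  f \oc i = 0 /\
  forall W (h : Hom W Y), f \oc h = 0 -> exists! u : Hom W X, i \oc u = h.

Definition is_cokernel (X Y Z : C) (f : Hom X Y) (q : Hom Y Z) : Prop :=
  q \oc f = 0 /\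
  forall W (h : Hom Y W), h \oc f = 0 -> exists! u : Hom Z W, u \oc q = h.

Definition short_exact (X Y Z : C) (i : Hom X Y) (q : Hom Y Z) : Prop :=
  is_kernel i q /\ is_cokernel i q.

Definition is_simple (S : C) : Prop :=
  ~ is_zero_object S /\
  forall X (i : Hom X S), is_mono i -> is_zero_object X \/ is_iso i.

(* [has_length n X]: X has a composition series with n factors. *)
Inductive has_length : nat -> C -> Prop :=
| has_length0 X : is_zero_object X -> has_length 0 X
| has_lengthS n X Y S (i : Hom X Y) (q : Hom Y S) :
    has_length n X -> short_exact i q -> is_simple S -> has_length n.+1 Y.

End LinearCategory.

Definition additive_cat (k : comPzRingType) (C : linCat k) : Prop :=
  (exists Z : C, is_zero_object Z) /\
  (forall X Y : C, exists S : C, is_biproduct X Y S).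

Definition abelian_cat (k : comPzRingType) (C : linCat k) : Prop :=
  [/\ additive_cat C,
      forall (X Y : C) (f : Hom X Y), exists (K : C) (i : Hom K X), is_kernel i f,
      forall (X Y : C) (f : Hom X Y), exists (Q : C) (q : Hom Y Q), is_cokernel f q,
      forall (X Y : C) (f : Hom X Y), is_mono f ->
        exists (Z : C) (g : Hom Y Z), is_kernel f g
    & forall (X Y : C) (f : Hom X Y), is_epi f ->
        exists (W : C) (g : Hom W X), is_cokernel g f].

Definition length_cat (k : comPzRingType) (C : linCat k) : Prop :=
  forall X : C, exists n, has_length n X.

(** ** Hom-finiteness *)

Section ModuleLength.
Context {k : comPzRingType} {M : lmodType k}.

Definition is_submodule (N : set M) : Prop :=
  N 0 /\ forall (a : k) (u v : M), N u -> N v -> N (a *: u + v).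

(* N' is a maximal proper submodule of N, i.e. N / N' is simple. *)
Definition is_maximal_in (N' N : set M) : Prop :=
  N' `<` N /\
  forall L, is_submodule L -> N' `<=` L -> L `<=` N -> L = N' \/ L = N.

End ModuleLength.

Definition finite_length_module (k : comPzRingType) (M : lmodType k) : Prop :=
  exists (n : nat) (N : nat -> set M),
  [/\ forall i, is_submodule (N i),
      N 0%N = [set 0], N n = setT
    & forall i, (i < n)%N -> is_maximal_in (N i) (N i.+1)].

Definition hom_finite (k : comPzRingType) (C : linCat k) : Prop :=
  forall X Y : C, finite_length_module (Hom X Y).

(** ** Characters *)

Section Characters.
Context {k : comPzRingType} (C : linCat k).

Definition is_character (chi : C -> nat) : Prop :=
  (forall X Y S : C, is_biproduct X Y S -> chi S = (chi X + chi Y)%N) /\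
  (forall (X Y Z : C) (f : Hom X Y) (q : Hom Y Z),
     is_cokernel f q -> (chi Y <= chi X + chi Z)%N).

Definition zero_character : C -> nat := fun=> 0%N.

Definition is_irreducible (chi : C -> nat) : Prop :=
  [/\ is_character chi, chi <> zero_character
    & ~ exists chi1 chi2 : C -> nat,
        [/\ is_character chi1, is_character chi2,
            chi1 <> zero_character, chi2 <> zero_character
          & chi = (fun X => chi1 X + chi2 X)%N]].

Definition Sp : set (C -> nat) := [set chi | is_irreducible chi].

End Characters.

Arguments zero_character {k} C.
Arguments Sp {k} C.

(** ** Full subcategories *)

Section FullSubcategory.
Context {k : comPzRingType} {C : linCat k}.

Definition full_sub (D : set C) : linCat k :=
  @LinCat k {X : C | D X}
    (fun X Y => Hom (sval X) (sval Y))
    (fun X => idm (sval X))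
    (fun X Y Z g f => g \oc f)
    (fun W X Y Z h g f => hcompA h g f)
    (fun X Y f => hcomp_idl f)
    (fun X Y f => hcomp_idr f)
    (fun X Y Z f => @hcomp_linearl k C _ _ _ f)
    (fun X Y Z g => @hcomp_linearr k C _ _ _ g).

(* In particular such a D is closed under isomorphism in C. *)
Definition subobject_closed_subcat (D : set C) : Prop :=
  additive_cat (full_sub D) /\
  forall (X Y : C) (i : Hom X Y), is_mono i -> D Y -> D X.

(* p is the object part of a left adjoint of the inclusion of D into C; its
   action on morphisms is determined by the universal property of the unit. *)
Definition is_left_adjoint (D : set C) (p : C -> full_sub D) : Prop :=
  exists eta : forall X : C, Hom X (sval (p X)),
  forall (X : C) (Y : full_sub D) (f : Hom X (sval Y)),
  exists! g : Hom (p X) Y, (g : Hom (sval (p X)) (sval Y)) \oc eta X = f.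

(* Sp D as a subset of Sp C: the image of chi |-> chi \o p. *)
Definition Sp_sub (D : set C) : set (C -> nat) :=
  [set psi : C -> nat | exists (p : C -> full_sub D) (chi : full_sub D -> nat),
     [/\ is_left_adjoint p, Sp (full_sub D) chi & psi = chi \o p]].

Definition subobject_closed (U : set (C -> nat)) : Prop :=
  exists D : set C, subobject_closed_subcat D /\ U = Sp_sub D.

Definition sub (chi : C -> nat) : set (C -> nat) :=
  \bigcap_(U in [set U | subobject_closed U /\ U chi]) U.

End FullSubcategory.

(* Main.v *)
From Pilot Require Import Defs.
From mathcomp Require Import all_boot all_algebra.
From mathcomp Require Import boolp classical_sets.
From mathcomp Require Import zify.
Import Pilot.Defs.

Set Implicit Arguments.
Unset Strict Implicit.
Unset Printing Implicit Defensive.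

Import GRing.Theory.
Local Open Scope ring_scope.

(** A character [chi] is determined by the ranks [rk chi f = chi Y - chi (Coker f)]
    of the morphisms [f : X -> Y]; these satisfy Frobenius' inequality
    ([rk_frobenius]).

    The invariant [sub chi] amounts to a subcategory. Call [X] cogenerated by [chi]
    if every non-zero morphism to [X] has positive rank. The cogenerated objects
    form the smallest subobject-closed subcategory [D] with [chi] in [Sp D]
    ([cogenerated_subobject_closed], [Sp_sub_cogenerated],
    [cogenerated_minimal]). So [sub chi = sub psi] implies that [chi] and [psi]
    cogenerate the same objects, and then that the same morphisms have rank 0 for
    [chi] and for [psi] ([cogenerated_rk0]). It remains to see that two different
    irreducible characters cannot cogenerate the same objects.

    Irreducible characters that differ are disjoint. The morphisms out of [X], where
    [b <= a] means that [b] factors through [a], are the finitely generated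
    subfunctors of [Hom X -]. They form a lattice, on which [rk chi] and [rk psi]
    are valuations. Take the minimum of the two increments on every step of a finite
    chain from the identity to 0, and minimise the sum over all chains: this infimum
    of the two valuations is a character, whose difference to [chi] and to [psi] is
    a character too. If both are irreducible and distinct, it vanishes
    ([irreducible_common0]). So on each [X] there is a chain of subfunctors such
    that on each step one of the two ranks is constant.

    Call [a : X -> Y] faithful if [a u] has positive rank for each non-zero [u] to
    [X]. Since the same morphisms have rank 0, faithfulness for [chi] and for [psi]
    agree. If [X] is a non-zero cogenerated object, the identity of [X] is faithful.
    Choose [a] faithful with the sum of its two ranks minimal. The chain from [a] to
    0 given by disjointness has a first member [c] with smaller ranks, and there one
    of the two ranks, say that for [psi], is still the rank of [a]. Frobenius'
    inequality shows that [c] is faithful for [psi], hence for [chi], which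
    contradicts minimality ([cogenerated_inj]). For characters given by objects [M]
    and [N] that embed into powers of each other, this argument says that the
    composites [M -> N -> M] cannot all lie in the radical of [End M]. *)

(** * Composition, cokernels and biproducts in a linear category *)

Section LinearBasics.
Context {k : comPzRingType} {C : linCat k}.
Implicit Types X Y Z W S : C.

Lemma hcompDl X Y Z (g h : Hom Y Z) (f : Hom X Y) :
  (g + h) \oc f = g \oc f + h \oc f.
Proof. by have := @hcomp_linearl _ _ _ _ _ f 1 g h; rewrite !scale1r. Qed.

Lemma hcompDr X Y Z (g : Hom Y Z) (f h : Hom X Y) :
  g \oc (f + h) = g \oc f + g \oc h.
Proof. by have := @hcomp_linearr _ _ _ _ _ g 1 f h; rewrite !scale1r. Qed.

Lemma hcomp0l X Y Z (f : Hom X Y) : (0 : Hom Y Z) \oc f = 0.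
Proof. by apply: (addrI (0 \oc f)); rewrite -hcompDl !addr0. Qed.

Lemma hcomp0r X Y Z (g : Hom Y Z) : g \oc (0 : Hom X Y) = 0.
Proof. by apply: (addrI (g \oc 0)); rewrite -hcompDr !addr0. Qed.

Lemma hcompNl X Y Z (g : Hom Y Z) (f : Hom X Y) : (- g) \oc f = - (g \oc f).
Proof. by apply: (addrI (g \oc f)); rewrite -hcompDl !subrr hcomp0l. Qed.

Lemma hcompNr X Y Z (g : Hom Y Z) (f : Hom X Y) : g \oc (- f) = - (g \oc f).
Proof. by apply: (addrI (g \oc f)); rewrite -hcompDr !subrr hcomp0r. Qed.

Lemma hcompBl X Y Z (g h : Hom Y Z) (f : Hom X Y) :
  (g - h) \oc f = g \oc f - h \oc f.
Proof. by rewrite hcompDl hcompNl. Qed.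

Lemma hcompBr X Y Z (g : Hom Y Z) (f h : Hom X Y) :
  g \oc (f - h) = g \oc f - g \oc h.
Proof. by rewrite hcompDr hcompNr. Qed.

Lemma epi_of_cancel0 X Y (f : Hom X Y) :
  (forall Z (g : Hom Y Z), g \oc f = 0 -> g = 0) -> is_epi f.
Proof.
move=> f0 Z u v /eqP; rewrite -subr_eq0 -hcompBl => /eqP /f0 /eqP.
by rewrite subr_eq0 => /eqP.
Qed.

Lemma epi_cancel0 X Y Z (f : Hom X Y) (g : Hom Y Z) :
  is_epi f -> g \oc f = 0 -> g = 0.
Proof. by move=> fE gf; apply: fE; rewrite gf hcomp0l. Qed.

Lemma mono_cancel0 X Y Z (f : Hom X Y) (g : Hom Y Z) :
  is_mono g -> g \oc f = 0 -> f = 0.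
Proof. by move=> gM gf; apply: gM; rewrite gf hcomp0r. Qed.

Lemma mono_of_cancel0 X Y (f : Hom X Y) :
  (forall Z (g : Hom Z X), f \oc g = 0 -> g = 0) -> is_mono f.
Proof.
move=> f0 Z u v /eqP; rewrite -subr_eq0 -hcompBr => /eqP /f0 /eqP.
by rewrite subr_eq0 => /eqP.
Qed.

Lemma epi_comp X Y Z (g : Hom Y Z) (f : Hom X Y) :
  is_epi g -> is_epi f -> is_epi (g \oc f).
Proof. by move=> gE fE W u v; rewrite !hcompA => /fE /gE. Qed.

Lemma cokernel_epi X Y Z (f : Hom X Y) (q : Hom Y Z) :
  is_cokernel f q -> is_epi q.
Proof.
move=> [qf0 univ] W u v uv.
have vqf : (v \oc q) \oc f = 0 by rewrite -hcompA qf0 hcomp0r.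
by have [w [_ wU]] := univ _ _ vqf; rewrite -(wU u uv) -(wU v erefl).
Qed.

Lemma cokernel_fact X Y Z W (f : Hom X Y) (q : Hom Y Z) (h : Hom Y W) :
  is_cokernel f q -> h \oc f = 0 -> exists u : Hom Z W, u \oc q = h.
Proof. by move=> [_ univ] /univ [u [uh _]]; exists u. Qed.

Lemma kernel_mono X Y Z (i : Hom X Y) (f : Hom Y Z) :
  is_kernel i f -> is_mono i.
Proof.
move=> [fi0 univ] W u v uv.
have fiv : f \oc (i \oc v) = 0 by rewrite hcompA fi0 hcomp0l.
by have [w [_ wU]] := univ _ _ fiv; rewrite -(wU u uv) -(wU v erefl).
Qed.

Lemma kernel_fact X Y Z W (i : Hom X Y) (f : Hom Y Z) (h : Hom W Y) :
  is_kernel i f -> f \oc h = 0 -> exists u : Hom W X, i \oc u = h.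
Proof. by move=> [_ univ] /univ [u [uh _]]; exists u. Qed.

Lemma epi_factor_cokernel X Y Z (f : Hom X Y) (q : Hom Y Z) :
  is_epi q -> q \oc f = 0 ->
  (forall W (h : Hom Y W), h \oc f = 0 -> exists u : Hom Z W, u \oc q = h) ->
  is_cokernel f q.
Proof.
move=> qE qf0 univ; split=> // W h /univ [u uh].
by exists u; split=> // v vh; apply: qE; rewrite uh vh.
Qed.

Lemma mono_factor_kernel X Y Z (i : Hom X Y) (f : Hom Y Z) :
  is_mono i -> f \oc i = 0 ->
  (forall W (h : Hom W Y), f \oc h = 0 -> exists u : Hom W X, i \oc u = h) ->
  is_kernel i f.
Proof.
move=> iM fi0 univ; split=> // W h /univ [u uh].
by exists u; split=> // v vh; apply: iM; rewrite uh vh.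
Qed.

Lemma cokernel0_idm (W : C) X : is_cokernel (0 : Hom W X) (idm X).
Proof.
apply: epi_factor_cokernel; rewrite ?hcomp0r //.
- by move=> Z u v; rewrite !hcomp_idr.
- by move=> Z h _; exists h; rewrite hcomp_idr.
Qed.

Lemma cokernel_idm0 X (Z : C) : is_zero_object Z ->
  is_cokernel (idm X) (0 : Hom X Z).
Proof.
move=> [Zin Zout]; apply: epi_factor_cokernel; rewrite ?hcomp0l //.
by move=> W h; rewrite hcomp_idr => ->; exists 0; rewrite hcomp0r.
Qed.

Lemma cokernel_precomp_epi X X' Y Z (e : Hom X' X) (f : Hom X Y) (q : Hom Y Z) :
  is_epi e -> is_cokernel f q -> is_cokernel (f \oc e) q.
Proof.
move=> eE fq; apply: epi_factor_cokernel.
- exact: cokernel_epi fq.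
- by rewrite hcompA fq.1 hcomp0l.
- move=> W h; rewrite hcompA => /(epi_cancel0 eE).
  exact: cokernel_fact fq.
Qed.

(** The square below is a pushout: the cokernel of [b \oc f] is glued from the
    cokernel of [f] along [b]. Applied to this exact sequence, the inequality for
    characters yields Frobenius' inequality for ranks. *)
Lemma pushout_cokernel X Y Y' Z Z' S (f : Hom X Y) (b : Hom Y Y')
    (q : Hom Y Z) (q' : Hom Y' Z') (z : Hom Z Z')
    (i1 : Hom Y' S) (i2 : Hom Z S) (p1 : Hom S Y') (p2 : Hom S Z) :
  is_cokernel f q -> is_cokernel (b \oc f) q' -> z \oc q = q' \oc b ->
  p1 \oc i1 = idm Y' -> p2 \oc i2 = idm Z -> p1 \oc i2 = 0 -> p2 \oc i1 = 0 ->
  i1 \oc p1 + i2 \oc p2 = idm S ->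
  is_cokernel (i1 \oc b + i2 \oc q) (q' \oc p1 - z \oc p2).
Proof.
move=> fq bfq zq p11 p22 p12 p21 ip.
have c1 : (q' \oc p1 - z \oc p2) \oc i1 = q'.
  by rewrite hcompBl -!hcompA p11 p21 hcomp0r subr0 hcomp_idr.
have c2 : (q' \oc p1 - z \oc p2) \oc i2 = - z.
  by rewrite hcompBl -!hcompA p12 p22 hcomp0r sub0r hcomp_idr.
apply: epi_factor_cokernel.
- move=> W u v uv; apply: (cokernel_epi bfq).
  by rewrite -c1 !hcompA uv.
- by rewrite hcompDr !hcompA c1 c2 hcompNl zq subrr.
- move=> W h; rewrite hcompDr !hcompA => hbq.
  have hb : (h \oc i1) \oc (b \oc f) = 0.
    have := congr1 (fun t => t \oc f) hbq.
    by rewrite hcompDl hcomp0l -!hcompA fq.1 !hcomp0r addr0.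
  have [u uq] := cokernel_fact bfq hb.
  exists u; rewrite hcompBr -(hcomp_idr h) -ip hcompDr !hcompA uq; congr (_ + _).
  rewrite -hcompNl; congr (_ \oc _).
  apply: (cokernel_epi fq); rewrite hcompNl -hcompA zq hcompA uq.
  by apply/eqP; rewrite eq_sym -addr_eq0 addrC hbq.
Qed.

End LinearBasics.

(** * Ranks of morphisms *)

Section Rank.
Context {k : comPzRingType} {C : linCat k} (abelC : abelian_cat C).
Implicit Types X Y Z W S : C.

Lemma cokernel_exists X Y (f : Hom X Y) :
  exists (Z : C) (q : Hom Y Z), is_cokernel f q.
Proof. by case: abelC. Qed.

Lemma kernel_exists X Y (f : Hom X Y) :
  exists (Z : C) (q : Hom Z X), is_kernel q f.
Proof. by case: abelC. Qed.

Lemma zero_object_exists : exists Z : C, is_zero_object Z.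
Proof. by case: abelC => [[]]. Qed.

Lemma biproduct_exists X Y : exists S, is_biproduct X Y S.
Proof. by case: abelC => [[]]. Qed.

Lemma epi_is_cokernel X Y (f : Hom X Y) :
  is_epi f -> exists (W : C) (g : Hom W X), is_cokernel g f.
Proof. by case: abelC => _ _ _ _ h /h. Qed.

Lemma mono_is_kernel X Y (f : Hom X Y) :
  is_mono f -> exists (W : C) (g : Hom Y W), is_kernel f g.
Proof. by case: abelC => _ _ _ h _ /h. Qed.

Definition coker_ob X Y (f : Hom X Y) : C := sval (cid (cokernel_exists f)).

(** The dimension of vector spaces gives the rank of matrices in this way. *)
Definition rk (chi : C -> nat) X Y (f : Hom X Y) : nat :=
  (chi Y - chi (coker_ob f))%N.

Context {chi : C -> nat} (chiC : is_character chi).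

Lemma character_zero Z : is_zero_object Z -> chi Z = 0%N.
Proof.
move=> Z0; have : is_biproduct Z Z Z.
  exists (idm Z), 0, (idm Z), 0; split; by apply Z0.1.
by move/chiC.1; lia.
Qed.

Lemma character_cokernel_le X Y Z (f : Hom X Y) (q : Hom Y Z) :
  is_cokernel f q -> (chi Z <= chi Y)%N.
Proof.
move=> /cokernel_epi qE; have [O O0] := zero_object_exists.
have /(chiC.2) := cokernel_precomp_epi qE (cokernel_idm0 _ O0).
by rewrite (character_zero O0) addn0.
Qed.

Lemma character_epi_le Y Z (q : Hom Y Z) : is_epi q -> (chi Z <= chi Y)%N.
Proof. by move=> /epi_is_cokernel [W [g /character_cokernel_le]]. Qed.

Lemma character_mono_split X Y (i : Hom X Y) (r : Hom Y X) :
  r \oc i = idm X -> (chi X <= chi Y)%N.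
Proof.
move=> ri; apply: (@character_epi_le _ _ r) => W u v uv.
by rewrite -(hcomp_idr u) -(hcomp_idr v) -ri !hcompA uv.
Qed.

Lemma character_iso X Y (f : Hom X Y) (g : Hom Y X) :
  g \oc f = idm X -> f \oc g = idm Y -> chi X = chi Y.
Proof.
move=> /character_mono_split XY /character_mono_split YX.
by apply/eqP; rewrite eqn_leq XY YX.
Qed.

Lemma cokernel_uniq X Y Z Z' (f : Hom X Y) (q : Hom Y Z) (q' : Hom Y Z') :
  is_cokernel f q -> is_cokernel f q' -> chi Z = chi Z'.
Proof.
move=> fq fq'.
have [u uq] := cokernel_fact fq fq'.1.
have [v vq] := cokernel_fact fq' fq.1.
apply: (@character_iso _ _ u v).
- by apply: (cokernel_epi fq); rewrite -hcompA uq vq hcomp_idl.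
- by apply: (cokernel_epi fq'); rewrite -hcompA vq uq hcomp_idl.
Qed.

Lemma rkE X Y Z (f : Hom X Y) (q : Hom Y Z) :
  is_cokernel f q -> (rk chi f + chi Z = chi Y)%N.
Proof.
move=> fq; rewrite /rk /coker_ob; case: cid => Z' /= [q' fq'].
rewrite (cokernel_uniq fq fq') subnK //.
exact: character_cokernel_le fq'.
Qed.

Lemma rk_idm X : rk chi (idm X) = chi X.
Proof.
have [O O0] := zero_object_exists.
by have := rkE (cokernel_idm0 X O0); rewrite (character_zero O0) addn0.
Qed.

Lemma rk0 X Y : rk chi (0 : Hom X Y) = 0%N.
Proof. by have := rkE (cokernel0_idm X Y); lia. Qed.

Lemma pushout_le X Y Y' Z Z' (f : Hom X Y) (b : Hom Y Y')
    (q : Hom Y Z) (q' : Hom Y' Z') :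
  is_cokernel f q -> is_cokernel (b \oc f) q' ->
  (chi Y' + chi Z <= chi Y + chi Z')%N.
Proof.
move=> fq bfq'.
have q'b : (q' \oc b) \oc f = 0 by rewrite -hcompA bfq'.1.
have [z zq] := cokernel_fact fq q'b.
have [S bS] := biproduct_exists Y' Z.
rewrite -(chiC.1 _ _ _ bS); case: bS => i1 [i2 [p1 [p2 [p11 p22 p12 p21 ip]]]].
exact: chiC.2 (pushout_cokernel fq bfq' zq p11 p22 p12 p21 ip).
Qed.

(** Frobenius' inequality: [Coker (c b)] is the cokernel of a map to
    [Coker (c b a)] that factors over [Coker (b a)], where its cokernel is
    [Coker b]; these four objects form a pushout square. *)
Lemma rk_frobenius W X Y Z (c : Hom Y Z) (b : Hom X Y) (a : Hom W X) :
  (rk chi (b \oc a) + rk chi (c \oc b) <= rk chi b + rk chi (c \oc (b \oc a)))%N.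
Proof.
have [Qba [q1 ba_q]] := cokernel_exists (b \oc a).
have [Qcb [q2 cb_q]] := cokernel_exists (c \oc b).
have [Qb [q3 b_q]] := cokernel_exists b.
have [Qcba [q4 cba_q]] := cokernel_exists (c \oc (b \oc a)).
have [z zq] : exists z, z \oc q1 = q4 \oc c.
  by apply: (cokernel_fact ba_q); rewrite -hcompA cba_q.1.
(* Coker b and Coker (c b) are quotients of Coker (b a) and Coker (c b a) *)
have Qb_coker : exists t, t \oc q1 = q3 /\ is_cokernel (q1 \oc b) t.
  have [t tq] : exists t, t \oc q1 = q3.
    by apply: (cokernel_fact ba_q); rewrite hcompA b_q.1 hcomp0l.
  exists t; split=> //; apply: epi_factor_cokernel.
  - by move=> V u v uv; apply: (cokernel_epi b_q); rewrite -tq !hcompA uv.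
  - by rewrite hcompA tq b_q.1.
  - move=> V h; rewrite hcompA => /(cokernel_fact b_q) [u uh].
    by exists u; apply: (cokernel_epi ba_q); rewrite -hcompA tq.
have Qcb_coker : exists t, t \oc q4 = q2 /\ is_cokernel (z \oc (q1 \oc b)) t.
  have [t tq] : exists t, t \oc q4 = q2.
    by apply: (cokernel_fact cba_q); rewrite !hcompA -(hcompA q2) cb_q.1 hcomp0l.
  have zqb : z \oc (q1 \oc b) = q4 \oc (c \oc b) by rewrite hcompA zq hcompA.
  exists t; split=> //; apply: epi_factor_cokernel; rewrite ?zqb.
  - by move=> V u v uv; apply: (cokernel_epi cb_q); rewrite -tq !hcompA uv.
  - by rewrite hcompA tq cb_q.1.
  - move=> V h; rewrite hcompA => /(cokernel_fact cb_q) [u uh].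
    by exists u; apply: (cokernel_epi cba_q); rewrite -hcompA tq.
have [t1 [_ c1]] := Qb_coker; have [t2 [_ c2]] := Qcb_coker.
have := pushout_le c1 c2.
move: (rkE ba_q) (rkE cb_q) (rkE b_q) (rkE cba_q); lia.
Qed.

Lemma rk_postcomp_le X Y Z (c : Hom Y Z) (b : Hom X Y) :
  (rk chi (c \oc b) <= rk chi b)%N.
Proof.
have := rk_frobenius c b (0 : Hom X X).
by rewrite !hcomp0r !rk0 addn0 add0n.
Qed.

End Rank.

(** * The common part of two valuations *)

Section CommonPart.
Context {L : Type} (le : L -> L -> Prop) (join meet : L -> L -> L).

Definition is_lattice_preorder : Prop :=
  [/\ forall a, le a a,
      forall b a c, le a b -> le b c -> le a c,
      forall a b c, le (join a b) c <-> le a c /\ le b c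
    & forall a b c, le c (meet a b) <-> le c a /\ le c b].

Definition is_valuation (r : L -> nat) : Prop :=
  (forall a b, le a b -> (r a <= r b)%N) /\
  (forall a b, r (join a b) + r (meet a b) = r a + r b)%N.

Context (r1 r2 : L -> nat).

Inductive chain_cost : L -> L -> nat -> Prop :=
| chain_step a b : le b a -> chain_cost a b (minn (r1 a - r1 b) (r2 a - r2 b))
| chain_cat a b c m n :
    chain_cost a b m -> chain_cost b c n -> chain_cost a c (m + n).

(** Riesz' formula for the infimum of two additive functions, with chains in
    place of decompositions: an interval of the lattice has few direct summands,
    but all its finite filtrations are available. The default value 0 is taken when
    [b] is not below [a]. *)
Definition common (a b : L) : nat :=
  if pselect (exists n, `[< chain_cost a b n >]) is left ex then ex_minn ex
  else 0%N.

Lemma common_min a b n : chain_cost a b n -> (common a b <= n)%N.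
Proof.
move=> abn; rewrite /common; case: pselect => // ex.
by case: ex_minnP => m _; apply; apply/asboolP.
Qed.

Lemma common_cost a b : le b a -> chain_cost a b (common a b).
Proof.
move=> ba; rewrite /common; case: pselect => [ex|[]].
  by case: ex_minnP => m /asboolP.
by exists (minn (r1 a - r1 b) (r2 a - r2 b)); apply/asboolP/chain_step.
Qed.

Lemma common_le_l a b : le b a -> (common a b <= r1 a - r1 b)%N.
Proof. by move=> /chain_step/common_min/leq_trans; apply; apply: geq_minl. Qed.

Lemma common_le_r a b : le b a -> (common a b <= r2 a - r2 b)%N.
Proof. by move=> /chain_step/common_min/leq_trans; apply; apply: geq_minr. Qed.

Context (latL : is_lattice_preorder).
Context (val1 : is_valuation r1) (val2 : is_valuation r2).

Lemma chain_le a b n : chain_cost a b n -> le b a.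
Proof.
by case: latL => _ tr _ _; elim=> // {}a b0 c m n' _ ba _; move/tr; apply.
Qed.

Lemma valuation_eqv r a b : is_valuation r -> le a b -> le b a -> r a = r b.
Proof. by move=> [mono _] /mono ab /mono ba; apply/eqP; rewrite eqn_leq ab. Qed.

Lemma chain_eqv a b : le a b -> le b a -> chain_cost a b 0.
Proof.
move=> ab ba; have := chain_step ba.
by rewrite (valuation_eqv val1 ab ba) subnn min0n.
Qed.

Lemma chain_eqv2 a b a' b' n : le a a' -> le a' a -> le b b' -> le b' b ->
  chain_cost a b n -> chain_cost a' b' n.
Proof.
move=> aa' a'a bb' b'b abn.
have := chain_cat (chain_eqv a'a aa') (chain_cat abn (chain_eqv bb' b'b)).
by rewrite add0n addn0.
Qed.

Lemma join_le2 a b g : le b a -> le (join b g) (join a g).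
Proof.
case: latL => refl tr jP _ ba; have [a1 g1] := (jP a g _).1 (refl _).
by apply/jP; split=> //; apply: tr a1.
Qed.

Lemma meet_le2 a b g : le b a -> le (meet b g) (meet a g).
Proof.
case: latL => refl tr _ mP ba; have [b1 g1] := (mP b g _).1 (refl _).
by apply/mP; split=> //; apply: tr ba.
Qed.

(** Cutting a chain at [g] into a chain above and a chain below [g] splits the
    increment of every valuation, and the minimum is superadditive. *)
Lemma chain_split g a b n : chain_cost a b n ->
  exists n1 n2, [/\ chain_cost (join a g) (join b g) n1,
    chain_cost (meet a g) (meet b g) n2 & (n1 + n2 <= n)%N].
Proof.
elim=> {a b n}
  [a b ba|a b c m n _ [m1 [m2 [am1 am2 lem]]] _ [n1 [n2 [bn1 bn2 len]]]].
  exists (minn (r1 (join a g) - r1 (join b g)) (r2 (join a g) - r2 (join b g))).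
  exists (minn (r1 (meet a g) - r1 (meet b g)) (r2 (meet a g) - r2 (meet b g))).
  split; [exact/chain_step/join_le2|exact/chain_step/meet_le2|].
  have jba := join_le2 g ba; have mba := meet_le2 g ba.
  move: (val1.2 a g) (val1.2 b g) (val2.2 a g) (val2.2 b g).
  move: (val1.1 _ _ jba) (val1.1 _ _ mba) (val2.1 _ _ jba) (val2.1 _ _ mba).
  by move: (val1.1 _ _ ba) (val2.1 _ _ ba); lia.
exists (m1 + n1)%N, (m2 + n2)%N.
by split; [exact: chain_cat bn1|exact: chain_cat bn2|lia].
Qed.

Lemma chain_meet a b n g : le g a -> le b g -> chain_cost a b n ->
  exists n1 n2, [/\ chain_cost a g n1, chain_cost g b n2 & (n1 + n2 <= n)%N].
Proof.
case: latL => refl tr jP mP ga bg /(chain_split g) [n1 [n2 [c1 c2 le12]]].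
exists n1, n2; split=> //.
- apply: chain_eqv2 c1; try by apply/jP.
  + by apply: ((jP _ _ _).1 (refl _)).1.
  + by apply: ((jP _ _ _).1 (refl _)).2.
- apply: chain_eqv2 c2; try by apply/mP.
  + by apply: ((mP _ _ _).1 (refl _)).2.
  + by apply: ((mP _ _ _).1 (refl _)).1.
Qed.

Lemma common_add a g b : le g a -> le b g ->
  common a b = (common a g + common g b)%N.
Proof.
move=> ga bg; have tr : le b a by case: latL => _ tr _ _; apply: tr ga.
apply/eqP; rewrite eqn_leq; apply/andP; split.
  exact/common_min/(chain_cat (common_cost ga) (common_cost bg)).
have [n1 [n2 [c1 c2]]] := chain_meet ga bg (common_cost tr).
by apply: leq_trans; apply: leq_add; apply: common_min.
Qed.

Lemma common_eqv a b a' b' : le a a' -> le a' a -> le b b' -> le b' b -> le b a ->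
  common a b = common a' b'.
Proof.
move=> aa' a'a bb' b'b ba; apply/eqP; rewrite eqn_leq; apply/andP; split.
  apply/common_min/(chain_eqv2 a'a aa' b'b bb')/common_cost.
  by case: latL => _ tr _ _; exact: tr b'b (tr _ _ _ ba aa').
exact/common_min/(chain_eqv2 aa' a'a bb' b'b)/common_cost.
Qed.

(** On a chain of cost 0 each step leaves one of the two valuations constant. The
    first step that changes anything separates them. *)
Lemma chain_cost0_separates a b n : chain_cost a b n -> n = 0%N ->
  (r1 b = r1 a /\ r2 b = r2 a) \/
  exists c, [/\ le c a, (r1 c < r1 a)%N || (r2 c < r2 a)%N
               & (r1 c == r1 a) || (r2 c == r2 a)].
Proof.
elim=> {a b n} [a b ba min0|a b c m n abm IHab _ IHbc /eqP].
  case: (eqVneq (r1 b) (r1 a)) => e1; case: (eqVneq (r2 b) (r2 a)) => e2.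
  - by left.
  - right; exists b; rewrite e1 eqxx; split=> //; apply/orP; right.
    by rewrite ltn_neqAle e2 (val2.1 _ _ ba).
  - right; exists b; rewrite e2 eqxx orbT; split=> //; apply/orP; left.
    by rewrite ltn_neqAle e1 (val1.1 _ _ ba).
  - by move: (val1.1 _ _ ba) (val2.1 _ _ ba) min0 => ? ? ?; exfalso; lia.
rewrite addn_eq0 => /andP[/eqP m0 /eqP n0].
case: (IHab m0) => [[e1 e2]|]; last by right.
case: (IHbc n0); rewrite e1 e2; first by left.
move=> [d [db lt12 eq12]].
by right; exists d; split=> //; case: latL => _ tr _ _; exact: tr db (chain_le abm).
Qed.

End CommonPart.

(** This compares intervals in the lattices that belong to different objects. *)
Lemma chain_cost_map (L L' : Type) (le : L -> L -> Prop) (le' : L' -> L' -> Prop)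
    (r1 r2 : L -> nat) (r1' r2' : L' -> nat) (phi : L -> L') :
  (forall a b, le b a -> [/\ le' (phi b) (phi a),
     (r1' (phi a) - r1' (phi b) <= r1 a - r1 b)%N
   & (r2' (phi a) - r2' (phi b) <= r2 a - r2 b)%N]) ->
  forall a b n, chain_cost le r1 r2 a b n ->
  exists2 m, (m <= n)%N & chain_cost le' r1' r2' (phi a) (phi b) m.
Proof.
move=> phiP a b n.
elim=> {a b n} [a b /phiP [ba d1 d2]|a b c m n _ [m' mm' am'] _ [n' nn' bn']].
  exists (minn (r1' (phi a) - r1' (phi b)) (r2' (phi a) - r2' (phi b))).
    by move: d1 d2; lia.
  exact: chain_step.
by exists (m' + n')%N; [rewrite leq_add|apply: chain_cat bn'].
Qed.

(** * The lattice of morphisms starting at an object *)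

Section Outgoing.
Context {k : comPzRingType} {C : linCat k} (abelC : abelian_cat C).
Implicit Types X Y Z W S : C.

(** A morphism [a] out of [X] stands for the subfunctor of [Hom X -] formed by the
    morphisms that factor through [a]; these are the finitely generated
    subfunctors. *)
Record outgoing X := Outgoing { target : C; arrow : Hom X target }.

Definition out_le X (b a : outgoing X) : Prop :=
  exists g : Hom (target a) (target b), arrow b = g \oc arrow a.

Definition out_top X : outgoing X := Outgoing (idm X).
Definition out_bot X : outgoing X := Outgoing (0 : Hom X X).
Definition precomp X Y (f : Hom X Y) (b : outgoing Y) : outgoing X :=
  Outgoing (arrow b \oc f).

Definition out_rk (chi : C -> nat) X (a : outgoing X) : nat :=
  rk abelC chi (arrow a).

Lemma out_le_refl X (a : outgoing X) : out_le a a.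
Proof. by exists (idm _); rewrite hcomp_idl. Qed.

Lemma out_le_trans X (b a c : outgoing X) : out_le a b -> out_le b c -> out_le a c.
Proof. by move=> [g ab] [h bc]; exists (g \oc h); rewrite ab bc hcompA. Qed.

Lemma out_le_top X (a : outgoing X) : out_le a (out_top X).
Proof. by exists (arrow a); rewrite hcomp_idr. Qed.

Lemma out_zero_le X Y (a : outgoing X) : out_le (Outgoing (0 : Hom X Y)) a.
Proof. by exists 0; rewrite hcomp0l. Qed.

Lemma out_rk_mono chi X (a b : outgoing X) : is_character chi ->
  out_le a b -> (out_rk chi a <= out_rk chi b)%N.
Proof. by move=> chiC [g ab]; rewrite /out_rk ab; apply: rk_postcomp_le. Qed.

Lemma out_biproduct_lub X Y Y' S (a : Hom X Y) (b : Hom X Y')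
    (i1 : Hom Y S) (i2 : Hom Y' S) (p1 : Hom S Y) (p2 : Hom S Y') :
  p1 \oc i1 = idm Y -> p2 \oc i2 = idm Y' -> p1 \oc i2 = 0 -> p2 \oc i1 = 0 ->
  forall c, out_le (Outgoing (i1 \oc a + i2 \oc b)) c <->
            out_le (Outgoing a) c /\ out_le (Outgoing b) c.
Proof.
move=> p11 p22 p12 p21 c; split=> [[g /= jc]|[[g /= ac] [h /= bc]]].
  split; [exists (p1 \oc g)|exists (p2 \oc g)];
    rewrite /= -hcompA -jc hcompDr !hcompA.
    by rewrite p11 p12 hcomp0l hcomp_idl addr0.
  by rewrite p22 p21 hcomp0l hcomp_idl add0r.
by exists (i1 \oc g + i2 \oc h); rewrite /= hcompDl -!hcompA -ac -bc.
Qed.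

(** The join of [a] and [b] is the morphism with these two components, and their
    meet is the diagonal of their pushout, whose cokernel is the direct sum of the
    two cokernels. *)
Lemma out_lattice_exists X (a b : outgoing X) :
  exists jm : outgoing X * outgoing X,
  [/\ forall c, out_le jm.1 c <-> out_le a c /\ out_le b c,
      forall c, out_le c jm.2 <-> out_le c a /\ out_le c b
    & forall chi, is_character chi ->
      (out_rk chi jm.1 + out_rk chi jm.2 = out_rk chi a + out_rk chi b)%N].
Proof.
case: a b => Y a [Y' b].
have [S bS] := biproduct_exists abelC Y Y'.
have [i1 [i2 [p1 [p2 [p11 p22 p12 p21 ip]]]]] := bS.
have [P [c mc]] := cokernel_exists abelC (i1 \oc a + i2 \oc b).
have c12 : c \oc i1 \oc a = - (c \oc i2 \oc b).
  by apply/eqP; rewrite -addr_eq0 -!hcompA -hcompDr mc.1.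
exists (Outgoing (i1 \oc a + i2 \oc b), Outgoing (c \oc i1 \oc a)).
split=> /= [|d|chi chiC].
- exact: (out_biproduct_lub _ _ p11 p22 p12 p21).
- split=> [dm|[[g /= da] [h /= db]]].
    split; apply: out_le_trans dm _; first by exists (c \oc i1).
    by exists (- (c \oc i2)); rewrite /= hcompNl.
  have ghm : (g \oc p1 - h \oc p2) \oc (i1 \oc a + i2 \oc b) = 0.
    rewrite hcompBl !hcompDr -!(hcompA _ p1) -!(hcompA _ p2) !(hcompA p1).
    rewrite !(hcompA p2) p11 p12 p21 p22 !hcomp0l !hcomp_idl !hcomp0r.
    by rewrite addr0 add0r -da -db subrr.
  have [t tc] := cokernel_fact mc ghm.
  exists t; rewrite /= !hcompA tc hcompBl -!hcompA p11 p21 hcomp0r subr0.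
  by rewrite hcomp_idr.
- have [Ca [qa a_q]] := cokernel_exists abelC a.
  have [Cb [qb b_q]] := cokernel_exists abelC b.
  have [T bT] := biproduct_exists abelC Ca Cb.
  have [j1 [j2 [s1 [s2 [s11 s22 s12 s21 js]]]]] := bT.
  have wm : (j1 \oc qa \oc p1 + j2 \oc qb \oc p2) \oc (i1 \oc a + i2 \oc b) = 0.
    rewrite hcompDl !hcompDr -!(hcompA _ p1) -!(hcompA _ p2) !(hcompA p1).
    rewrite !(hcompA p2) p11 p12 p21 p22 !hcomp0l !hcomp_idl !hcomp0r.
    by rewrite -!hcompA a_q.1 b_q.1 !hcomp0r !addr0.
  have [w wc] := cokernel_fact mc wm.
  have w1 : w \oc (c \oc i1) = j1 \oc qa.
    by rewrite hcompA wc hcompDl -!hcompA p11 p21 !hcomp0r addr0 hcomp_idr.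
  have w2 : w \oc (c \oc i2) = j2 \oc qb.
    by rewrite hcompA wc hcompDl -!hcompA p12 p22 !hcomp0r add0r hcomp_idr.
  have diag_w : is_cokernel (c \oc i1 \oc a) w.
    apply: epi_factor_cokernel.
    + move=> V u v uv; rewrite -(hcomp_idr u) -(hcomp_idr v) -js !hcompDr !hcompA.
      congr (_ + _); congr (_ \oc _).
        by apply: (cokernel_epi a_q); rewrite -!hcompA -w1 !hcompA uv.
      by apply: (cokernel_epi b_q); rewrite -!hcompA -w2 !hcompA uv.
    + by rewrite hcompA w1 -hcompA a_q.1 hcomp0r.
    + move=> V h h1.
      have h2 : (h \oc (c \oc i2)) \oc b = 0.
        by rewrite -hcompA -[_ \oc b]opprK -c12 hcompNr h1 oppr0.
      rewrite hcompA in h1.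
      have [u1 u1q] := cokernel_fact a_q h1; have [u2 u2q] := cokernel_fact b_q h2.
      exists (u1 \oc s1 + u2 \oc s2); apply: (cokernel_epi mc).
      rewrite -hcompA wc -[RHS]hcomp_idr -ip hcompDl !hcompDr !hcompA.
      rewrite -!(hcompA _ _ j1) -!(hcompA _ _ j2) s11 s12 s21 s22.
      rewrite !hcomp0r !hcomp_idr !hcomp0l addr0 add0r u1q u2q.
      by rewrite !hcompA.
  rewrite /out_rk /=; move: (rkE abelC chiC diag_w) (rkE abelC chiC mc).
  move: (rkE abelC chiC a_q) (rkE abelC chiC b_q).
  by rewrite (chiC.1 _ _ _ bS) (chiC.1 _ _ _ bT); lia.
Qed.

Definition out_join X (a b : outgoing X) := (sval (cid (out_lattice_exists a b))).1.
Definition out_meet X (a b : outgoing X) := (sval (cid (out_lattice_exists a b))).2.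

Lemma out_lattice X : is_lattice_preorder (@out_le X) (@out_join X) (@out_meet X).
Proof.
split; [exact: out_le_refl|exact: out_le_trans| |] => a b c.
- by rewrite /out_join; case: cid => jm [].
- by rewrite /out_meet; case: cid => jm [].
Qed.

Lemma out_rk_valuation X chi : is_character chi ->
  is_valuation (@out_le X) (@out_join X) (@out_meet X) (out_rk chi (X := X)).
Proof.
move=> chiC; split=> a b; first exact: out_rk_mono.
by rewrite /out_join /out_meet; case: cid => jm /= [_ _ /(_ _ chiC)].
Qed.

Lemma out_rk_join_cokernel chi X Y Z (f : Hom X Y) (q : Hom Y Z) (b : outgoing Y) :
  is_character chi -> is_cokernel f q ->
  (out_rk chi (out_join b (Outgoing q)) = out_rk chi (precomp f b) + chi Z)%N.
Proof.
move=> chiC fq; case: b => Y' b.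
have [S bS] := biproduct_exists abelC Y' Z.
have [i1 [i2 [p1 [p2 [p11 p22 p12 p21 ip]]]]] := bS.
have [refl _ jP _] := out_lattice Y.
have lub := out_biproduct_lub b q p11 p22 p12 p21.
have -> : out_rk chi (out_join (Outgoing b) (Outgoing q)) =
          out_rk chi (Outgoing (i1 \oc b + i2 \oc q)).
  apply/eqP; rewrite eqn_leq; apply/andP; split; apply: out_rk_mono => //.
    by apply/jP/lub; apply: refl.
  by apply/lub/jP; apply: refl.
have [Z' [q' bfq']] := cokernel_exists abelC (b \oc f).
have q'b : (q' \oc b) \oc f = 0 by rewrite -hcompA bfq'.1.
have [z zq] := cokernel_fact fq q'b.
have := rkE abelC chiC (pushout_cokernel fq bfq' zq p11 p22 p12 p21 ip).
move: (rkE abelC chiC bfq'); rewrite (chiC.1 _ _ _ bS) /out_rk /=; lia.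
Qed.

End Outgoing.

(** * The common part of two characters *)

Section CommonCharacter.
Context {k : comPzRingType} {C : linCat k} (abelC : abelian_cat C).
Context (chi psi : C -> nat) (chiC : is_character chi) (psiC : is_character psi).
Implicit Types X Y Z W S : C.

Let chain X := chain_cost (@out_le k C X) (out_rk abelC chi (X := X))
                                          (out_rk abelC psi (X := X)).

Definition out_common X (a b : outgoing X) : nat :=
  common (@out_le k C X) (out_rk abelC chi (X := X)) (out_rk abelC psi (X := X))
    a b.

Definition common_character X : nat := out_common (out_top X) (out_bot X).

Lemma chain_precomp X Y (f : Hom X Y) (b b' : outgoing Y) n : chain b b' n ->
  exists2 m, (m <= n)%N & chain (precomp f b) (precomp f b') m.
Proof.
apply: chain_cost_map => a c [g ca]; split.
- by exists g; rewrite /= ca hcompA.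
- by have := rk_frobenius abelC chiC g (arrow a) f; rewrite /out_rk /= ca hcompA; lia.
- by have := rk_frobenius abelC psiC g (arrow a) f; rewrite /out_rk /= ca hcompA; lia.
Qed.

Lemma out_le_join_cokernel X Y Z (f : Hom X Y) (q : Hom Y Z) (b b' : outgoing Y) :
  is_cokernel f q -> out_le (precomp f b') (precomp f b) ->
  out_le (out_join abelC b' (Outgoing q)) (out_join abelC b (Outgoing q)).
Proof.
move=> fq [g /= b'b]; have [refl _ jP _] := out_lattice abelC Y.
have [[s bs] [t /= qt]] := (jP b (Outgoing q) _).1 (refl _).
apply/jP; split; last by exists t.
have d0 : (arrow b' - g \oc arrow b) \oc f = 0.
  by rewrite hcompBl b'b hcompA subrr.
have [h hq] := cokernel_fact fq d0.
exists (g \oc s + h \oc t).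
by rewrite hcompDl -!hcompA -bs -qt hq addrC subrK.
Qed.

(** Two morphisms with the same composite with [f] differ by one that factors through
    the cokernel [q]. Joining with [q] therefore lifts a chain below [f] to a
    chain above [q], and by [out_rk_join_cokernel] the increments stay the same. *)
Lemma chain_lift X Y Z (f : Hom X Y) (q : Hom Y Z) (a a' : outgoing X) n :
  is_cokernel f q -> chain a a' n ->
  forall b b', a = precomp f b -> a' = precomp f b' ->
  chain (out_join abelC b (Outgoing q)) (out_join abelC b' (Outgoing q)) n.
Proof.
move=> fq; elim=> {a a' n} [a a' a'a|a g a' m n cag IHag _ IHga] b b' ab a'b.
  have bb' : out_le (precomp f b') (precomp f b) by rewrite -ab -a'b.
  have -> : minn (out_rk abelC chi a - out_rk abelC chi a')
                 (out_rk abelC psi a - out_rk abelC psi a') =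
    minn (out_rk abelC chi (out_join abelC b (Outgoing q))
          - out_rk abelC chi (out_join abelC b' (Outgoing q)))
         (out_rk abelC psi (out_join abelC b (Outgoing q))
          - out_rk abelC psi (out_join abelC b' (Outgoing q))).
    by rewrite !(out_rk_join_cokernel _ _ _ fq) // -ab -a'b !subnDr.
  by apply: chain_step; apply: out_le_join_cokernel fq bb'.
have := chain_le (out_lattice abelC X) cag; rewrite ab => -[/= h gh].
have g_b : g = precomp f (Outgoing (h \oc arrow b)).
  by case: g h gh {cag IHag IHga} => G g /= h ->; rewrite /precomp /= hcompA.
exact: chain_cat (IHag _ _ ab g_b) (IHga _ _ g_b a'b).
Qed.

(** Precomposition with [f] identifies the interval from the cokernel of [f] to
    the identity with the interval from 0 to [f]: both describe the image of the
    map of functors given by [f]. *)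
Lemma out_common_cokernel X Y Z (f : Hom X Y) (q : Hom Y Z) : is_cokernel f q ->
  out_common (out_top Y) (Outgoing q) = out_common (Outgoing f) (out_bot X).
Proof.
move=> fq; have latX := out_lattice abelC X; have latY := out_lattice abelC Y.
have valX chi0 := out_rk_valuation abelC X (chi := chi0).
have valY chi0 := out_rk_valuation abelC Y (chi := chi0).
apply/eqP; rewrite eqn_leq; apply/andP; split.
  have cf := common_cost (out_rk abelC chi (X := X)) (out_rk abelC psi (X := X))
    (out_zero_le X (Outgoing f)).
  have ftop : Outgoing f = precomp f (out_top Y) by rewrite /precomp /= hcomp_idl.
  have fbot : out_bot X = precomp f (Outgoing (0 : Hom Y X)).
    by rewrite /precomp /= hcomp0l.
  have := chain_lift fq cf ftop fbot.
  have [refl _ jP _] := latY.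
  move=> /(chain_eqv2 (valY _ chiC)) cY.
  apply/common_min/cY.
  + exact: out_le_top.
  + by apply: ((jP _ _ _).1 (refl _)).1.
  + by apply/jP; split; [apply: out_zero_le|apply: refl].
  + by apply: ((jP _ _ _).1 (refl _)).2.
have cq := common_cost (out_rk abelC chi (X := Y)) (out_rk abelC psi (X := Y))
  (out_le_top (Outgoing q)).
have [m lem /(chain_eqv2 (valX _ chiC)) cX] := chain_precomp f cq.
apply: leq_trans lem; apply/common_min/cX.
- by exists (idm Y).
- by exists (idm Y); rewrite /= !hcomp_idl.
- by rewrite /precomp /= fq.1; apply: out_zero_le.
- exact: out_zero_le.
Qed.

(** The sequence of functors [0 -> Hom Z - -> Hom Y - -> Hom X -] is exact. Cutting
    the lattices at [X] and at [Y] at the image of the middle map leaves the interval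
    from [f] to the identity of [X], the cokernel of that map, as the defect. *)
Lemma common_character_cokernel X Y Z (f : Hom X Y) (q : Hom Y Z) :
  is_cokernel f q ->
  (common_character X + common_character Z =
   common_character Y + out_common (out_top X) (Outgoing f))%N.
Proof.
move=> fq; rewrite /common_character.
have add V := common_add (out_lattice abelC V)
  (out_rk_valuation abelC V chiC) (out_rk_valuation abelC V psiC).
have splitX := add X _ _ (out_bot X) (out_le_top (Outgoing f)) (out_zero_le _ _).
have splitY := add Y _ _ (out_bot Y) (out_le_top (Outgoing q)) (out_zero_le _ _).
have [O O0] := zero_object_exists abelC.
(* the interval from 0 to q is the whole lattice at Z: the cokernel of q is 0 *)
have q0 : is_cokernel q (0 : Hom Z O).
  have := cokernel_precomp_epi (cokernel_epi fq) (cokernel_idm0 Z O0).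
  by rewrite hcomp_idl.
have Zq := out_common_cokernel q0.
have Zbot : out_common (out_top Z) (Outgoing (0 : Hom Z O)) =
            out_common (out_top Z) (out_bot Z).
  rewrite /out_common; apply: (common_eqv _ (out_lattice abelC Z)
    (out_rk_valuation abelC Z chiC));
    by [apply: out_le_refl|apply: out_zero_le].
move: splitX splitY Zq Zbot (out_common_cokernel fq).
by rewrite /out_common => -> -> <- <- ->; lia.
Qed.

Lemma out_common_le_chi X Y (f : Hom X Y) :
  (out_common (out_top X) (Outgoing f) + rk abelC chi f <= chi X)%N.
Proof.
have := common_le_l (out_rk abelC chi (X := X)) (out_rk abelC psi (X := X))
  (out_le_top (Outgoing f)).
have := rk_postcomp_le abelC chiC f (idm X).
by rewrite /out_common /out_rk /= hcomp_idr rk_idm //; lia.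
Qed.

Lemma out_common_le_psi X Y (f : Hom X Y) :
  (out_common (out_top X) (Outgoing f) + rk abelC psi f <= psi X)%N.
Proof.
have := common_le_r (out_rk abelC chi (X := X)) (out_rk abelC psi (X := X))
  (out_le_top (Outgoing f)).
have := rk_postcomp_le abelC psiC f (idm X).
by rewrite /out_common /out_rk /= hcomp_idr rk_idm //; lia.
Qed.

Lemma biproduct_cokernel X Y S (i1 : Hom X S) (i2 : Hom Y S)
    (p1 : Hom S X) (p2 : Hom S Y) :
  p2 \oc i2 = idm Y -> p2 \oc i1 = 0 -> i1 \oc p1 + i2 \oc p2 = idm S ->
  is_cokernel i1 p2.
Proof.
move=> p22 p21 ip; apply: epi_factor_cokernel => //.
- by move=> W u v uv; rewrite -(hcomp_idr u) -(hcomp_idr v) -p22 !hcompA uv.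
- move=> W h h1; exists (h \oc i2).
  by rewrite -[RHS]hcomp_idr -ip hcompDr !hcompA h1 hcomp0l add0r.
Qed.

(** Additivity holds because a split monomorphism [i1] generates all morphisms out of
    its source, so that the defect of [common_character_cokernel] vanishes. *)
Lemma common_character_is_character : is_character common_character.
Proof.
split=> [X Y S|X Y Z f q /common_character_cokernel]; last by lia.
move=> [i1 [i2 [p1 [p2 [p11 p22 p12 p21 ip]]]]].
have := common_character_cokernel (biproduct_cokernel p22 p21 ip).
have := out_common_le_chi i1; have := rk_postcomp_le abelC chiC p1 i1.
by rewrite p11 rk_idm //; lia.
Qed.

(** The defects of [mu] in exact sequences bound those of the common part, so their
    difference satisfies the inequality for characters. For [mu] either of the two
    given characters will be inserted. *)
Lemma sub_common_is_character mu : is_character mu ->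
  (forall X Y (f : Hom X Y),
     (out_common (out_top X) (Outgoing f) + rk abelC mu f <= mu X)%N) ->
  is_character (fun X => mu X - common_character X)%N /\
  forall X, (common_character X <= mu X)%N.
Proof.
move=> muC mu_le.
have le_mu X : (common_character X <= mu X)%N.
  by have := mu_le _ _ (0 : Hom X X); rewrite (rk0 abelC muC) addn0.
split=> //; split=> [X Y S bS|X Y Z f q fq].
  rewrite (muC.1 _ _ _ bS) (common_character_is_character.1 _ _ _ bS).
  by move: (le_mu X) (le_mu Y); lia.
move: (common_character_cokernel fq) (mu_le _ _ f) (rkE abelC muC fq).
by move: (le_mu X) (le_mu Y) (le_mu Z); lia.
Qed.

Lemma irreducible_common mu : is_irreducible mu ->
  (forall X Y (f : Hom X Y),
     (out_common (out_top X) (Outgoing f) + rk abelC mu f <= mu X)%N) ->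
  common_character <> zero_character C -> mu = common_character.
Proof.
move=> [muC _ irr] mu_le lam0.
have [restC le_mu] := sub_common_is_character muC mu_le.
apply: contrapT => mu_lam; apply: irr.
exists common_character, (fun X => mu X - common_character X)%N; split=> //.
- exact: common_character_is_character.
- move=> rest0; apply: mu_lam; apply: funext => X.
  have := congr1 (fun t => t X) rest0; have := le_mu X.
  by rewrite /zero_character; lia.
- by apply: funext => X; rewrite subnKC.
Qed.

Lemma irreducible_common0 : is_irreducible chi -> is_irreducible psi ->
  chi <> psi -> forall X, common_character X = 0%N.
Proof.
move=> chiI psiI chi_psi X.
apply: contrapT => lamX; apply: chi_psi.
have lam0 : common_character <> zero_character C by move=> /(congr1 (fun t => t X)).
rewrite (irreducible_common chiI out_common_le_chi lam0).
exact/esym/(irreducible_common psiI out_common_le_psi lam0).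
Qed.

End CommonCharacter.

(** * Termination of quotients *)

Section Length.
Context {k : comPzRingType} {C : linCat k} (abelC : abelian_cat C).
Implicit Types X Y Z W S : C.

Lemma simple_epi S U (f : Hom U S) : is_simple S -> f <> 0 -> is_epi f.
Proof.
move=> [_ simpS] f0.
have [T [c fc]] := cokernel_exists abelC f.
have [K [i ci]] := kernel_exists abelC c.
have [f' if'] := kernel_fact ci fc.1.
have c0 : c = 0.
  case: (simpS _ _ (kernel_mono ci)) => [K0|[g [_ ig]]].
    by case: f0; rewrite -if' (K0.1 _ f' 0) hcomp0r.
  by rewrite -(hcomp_idr c) -ig hcompA ci.1 hcomp0l.
apply: epi_of_cancel0 => V g /(cokernel_fact fc) [u <-].
by rewrite c0 hcomp0r.
Qed.

Lemma has_length_iso n X Y (f : Hom X Y) (g : Hom Y X) :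
  g \oc f = idm X -> f \oc g = idm Y -> has_length n X -> has_length n Y.
Proof.
move=> gf fg Xn; case: Xn f g gf fg =>
  {n X} [X [Xin Xout]|n X' X S i q X'n [iq qi] simS] f g gf fg.
  apply: has_length0; split=> V u v.
    rewrite -(hcomp_idl u) -(hcomp_idl v) -fg -!hcompA.
    by rewrite (Xin _ (g \oc u) (g \oc v)).
  by rewrite -(hcomp_idr u) -(hcomp_idr v) -fg !hcompA (Xout _ (u \oc f) (v \oc f)).
have gK V (h : Hom V Y) : f \oc (g \oc h) = h by rewrite hcompA fg hcomp_idl.
have fK V (h : Hom X V) : (h \oc g) \oc f = h by rewrite -hcompA gf hcomp_idr.
have gK' V (h : Hom Y V) : (h \oc f) \oc g = h by rewrite -hcompA fg hcomp_idr.
apply: (has_lengthS (i := f \oc i) (q := q \oc g) X'n) simS; split.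
- apply: mono_factor_kernel.
  + move=> V u v uv; apply: (kernel_mono iq).
    by rewrite -(hcomp_idl i) -gf -!hcompA [f \oc (i \oc u)]hcompA uv -hcompA.
  + by rewrite hcompA fK iq.1.
  + move=> V h; rewrite -hcompA => /(kernel_fact iq) [u ui].
    by exists u; rewrite -hcompA ui gK.
- apply: epi_factor_cokernel.
  + apply: epi_comp; first exact: cokernel_epi qi.
    by move=> V u v uv; rewrite -(fK _ u) -(fK _ v) uv.
  + by rewrite hcompA fK qi.1.
  + move=> V h; rewrite hcompA => /(cokernel_fact qi) [u uq].
    by exists u; rewrite hcompA uq gK'.
Qed.

(** The map [Y -> Y' (+) Z] is a monomorphism because [b] is, hence the kernel of its
    cokernel [Z']. So what [z] kills comes from [Y], with component 0 in [Y']. *)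
Lemma pushout_mono X Y Y' Z Z' (f : Hom X Y) (b : Hom Y Y')
    (q : Hom Y Z) (q' : Hom Y' Z') (z : Hom Z Z') :
  is_cokernel f q -> is_cokernel (b \oc f) q' -> z \oc q = q' \oc b ->
  is_mono b -> is_mono z.
Proof.
move=> fq bfq' zq bM; apply: mono_of_cancel0 => V h zh.
have [S [i1 [i2 [p1 [p2 [p11 p22 p12 p21 ip]]]]]] := biproduct_exists abelC Y' Z.
have mc := pushout_cokernel fq bfq' zq p11 p22 p12 p21 ip.
have p1m : p1 \oc (i1 \oc b + i2 \oc q) = b.
  by rewrite hcompDr !hcompA p11 p12 hcomp0l hcomp_idl addr0.
have p2m : p2 \oc (i1 \oc b + i2 \oc q) = q.
  by rewrite hcompDr !hcompA p22 p21 hcomp0l hcomp_idl add0r.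
have mM : is_mono (i1 \oc b + i2 \oc q).
  by move=> W u v uv; apply: bM; rewrite -p1m -!hcompA uv.
have [W [g mg]] := mono_is_kernel abelC mM.
have [g' gg'] := cokernel_fact mc mg.1.
have gi2h : g \oc (i2 \oc h) = 0.
  rewrite -gg' -hcompA [X in g' \oc X]hcompBl -!hcompA !(hcompA p1) !(hcompA p2).
  by rewrite p12 p22 hcomp0l hcomp0r hcomp_idl zh subr0 hcomp0r.
have [t mt] := kernel_fact mg gi2h.
have t0 : t = 0.
  by apply: (mono_cancel0 bM); rewrite -p1m -hcompA mt hcompA p12 hcomp0l.
by rewrite -(hcomp_idl h) -p22 -hcompA -mt t0 !hcomp0r.
Qed.

(** This makes the repeated formation of proper quotients terminate. *)
Lemma proper_quotient_length n U Y Q (u : Hom U Y) (p : Hom Y Q) :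
  has_length n Y -> is_cokernel u p -> u <> 0 ->
  exists2 m, (m < n)%N & has_length m Q.
Proof.
move=> Yn; elim: Yn U Q u p =>
  {n Y} [Y [Y0 _]|n X Y S i q Xn IH [iq qi] simS] U Q u p up u0.
  by case: u0; apply: Y0.
case: (pselect (q \oc u = 0)) => [qu0|qu].
  (* u lands in X: then S is still a top factor of Q, with kernel X / u *)
  have [u' iu'] := kernel_fact iq qu0.
  have u'0 : u' <> 0 by move=> e; apply: u0; rewrite -iu' e hcomp0r.
  have [Q' [p' up']] := cokernel_exists abelC u'.
  have [m mn Q'm] := IH _ _ _ _ up' u'0.
  have iup : is_cokernel (i \oc u') p by rewrite iu'.
  have [j jp] : exists j, j \oc p' = p \oc i.
    by apply: (cokernel_fact up'); rewrite -hcompA iup.1.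
  have [s sp] := cokernel_fact up qu0.
  have jM := pushout_mono up' iup jp (kernel_mono iq).
  have sj : is_cokernel j s.
    apply: epi_factor_cokernel.
    - by move=> V a b ab; apply: (cokernel_epi qi); rewrite -sp !hcompA ab.
    - by apply: (epi_cancel0 (cokernel_epi up')); rewrite -hcompA jp hcompA sp qi.1.
    - move=> V h hj.
      have [t tq] : exists t, t \oc q = h \oc p.
        by apply: (cokernel_fact qi); rewrite -hcompA -jp hcompA hj hcomp0l.
      by exists t; apply: (cokernel_epi up); rewrite -hcompA sp.
  exists m.+1 => //; apply: (has_lengthS Q'm _ simS (i := j) (q := s)).
  split=> //; have [W [g jg]] := mono_is_kernel abelC jM.
  have [g' gg'] := cokernel_fact sj jg.1.
  apply: mono_factor_kernel => // [|V h sh]; first exact: sj.1.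
  by apply: (kernel_fact jg); rewrite -gg' -hcompA sh hcomp0r.
(* otherwise X and the image of u span Y, and Q is a quotient of X *)
have quE := simple_epi simS qu.
have piE : is_epi (p \oc i).
  apply: epi_of_cancel0 => V g; rewrite hcompA => /(cokernel_fact qi) [g' gq].
  have g'0 : g' = 0.
    by apply: (epi_cancel0 quE); rewrite hcompA gq -hcompA up.1 hcomp0r.
  by apply: (epi_cancel0 (cokernel_epi up)); rewrite -gq g'0 hcomp0l.
have [V [v vpi]] := epi_is_cokernel abelC piE.
case: (pselect (v = 0)) => [v0|/(IH _ _ _ _ vpi) [m mn Qm]]; last first.
  by exists m => //; apply: ltnW.
have [t tpi] : exists t, t \oc (p \oc i) = idm X.
  by apply: (cokernel_fact vpi); rewrite v0 hcomp0r.
exists n => //; apply: (has_length_iso tpi _ Xn).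
by apply: piE; rewrite -hcompA tpi hcomp_idr hcomp_idl.
Qed.

End Length.

(** * The subcategory cogenerated by a character *)

Section Cogenerated.
Context {k : comPzRingType} {C : linCat k} (abelC : abelian_cat C).
Context (lenC : length_cat C) (chi : C -> nat) (chiC : is_character chi).
Implicit Types X Y Z W S : C.

(** For the character of an object [M] these are the subobjects of finite direct
    sums of copies of [M]: dividing out a non-zero subobject loses morphisms to
    [M]. *)
Definition cogenerated : set C :=
  fun X => forall U (u : Hom U X), u <> 0 -> (0 < rk abelC chi u)%N.

Lemma cogenerated_subobject_closed : subobject_closed_subcat cogenerated.
Proof.
split; last first.
  move=> X Y i iM DY U u u0.
  apply: leq_trans (rk_postcomp_le abelC chiC i u); apply: DY => iu.
  by apply: u0; apply: mono_cancel0 iu.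
split.
  have [O O0] := zero_object_exists abelC.
  have DO : cogenerated O by move=> U u; case; apply: O0.1.
  exists (exist _ O DO : full_sub cogenerated).
  by split=> X f g; [apply: O0.1|apply: O0.2].
move=> [X DX] [Y DY]; have [S bS] := biproduct_exists abelC X Y.
have [i1 [i2 [p1 [p2 [p11 p22 p12 p21 ip]]]]] := bS.
suff DS : cogenerated S.
  by exists (exist _ S DS : full_sub cogenerated), i1, i2, p1, p2.
move=> U u u0; case: (pselect (p1 \oc u = 0)) => [p1u|/DX p1u]; last first.
  exact: leq_trans p1u (rk_postcomp_le abelC chiC _ _).
case: (pselect (p2 \oc u = 0)) => [p2u|/DY p2u]; last first.
  exact: leq_trans p2u (rk_postcomp_le abelC chiC _ _).
case: u0; rewrite -(hcomp_idl u) -ip hcompDl -!hcompA p1u p2u.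
by rewrite !hcomp0r addr0.
Qed.

(** Divide out morphisms of rank 0 until there are none left. *)
Lemma cogenerated_quotient_exists X :
  exists Q (p : Hom X Q), [/\ cogenerated Q, is_epi p & chi Q = chi X].
Proof.
have [n] := lenC X.
elim/ltn_ind: n X => n IH X Xn.
case: (pselect (cogenerated X)) => [DX|].
  by exists X, (idm X); split=> // Z a b; rewrite !hcomp_idr.
move=> /existsNP[U /existsNP[u /not_implyP[u0 /negP]]].
rewrite -eqn0Ngt => /eqP rku.
have [Y [q uq]] := cokernel_exists abelC u.
have [m mn Ym] := proper_quotient_length abelC Xn uq u0.
have [Q [p [DQ pE chiQ]]] := IH m mn Y Ym.
exists Q, (p \oc q); split=> //; first exact: epi_comp pE (cokernel_epi uq).
by rewrite chiQ -(rkE abelC chiC uq) rku.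
Qed.

(** Such a quotient is the reflection: the kernel of [p] has rank 0, so every
    morphism to a cogenerated object vanishes on it. *)
Lemma cogenerated_reflection X Q (p : Hom X Q) :
  is_epi p -> chi Q = chi X -> forall Y (f : Hom X Y), cogenerated Y ->
  exists! g : Hom Q Y, g \oc p = f.
Proof.
move=> pE chiQ Y f DY; have [W [w wp]] := epi_is_cokernel abelC pE.
have fw : f \oc w = 0.
  apply: contrapT => /DY fw.
  have := rk_postcomp_le abelC chiC f w; have := rkE abelC chiC wp.
  by rewrite chiQ; lia.
have [g gp] := cokernel_fact wp fw.
by exists g; split=> // h hp; apply: pE; rewrite gp hp.
Qed.

End Cogenerated.

(** * Characters of subobject-closed subcategories *)

Section Subcategory.
Context {k : comPzRingType} {C : linCat k} (D : set C).
Implicit Types X Y Z W S : C.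

Lemma sub_character_iso (chi : full_sub D -> nat) (X Y : full_sub D)
    (f : Hom X Y) (g : Hom Y X) :
  is_character chi -> (exists O : full_sub D, is_zero_object O) ->
  g \oc f = idm X -> f \oc g = idm Y -> chi X = chi Y.
Proof.
move=> chiD [O [O1 O2]] gf fg.
have chiO : chi O = 0%N.
  have : is_biproduct O O O.
    by exists (idm O), 0, (idm O), 0; split; apply O1.
  by move/chiD.1; lia.
have bXO : is_biproduct X O Y.
  by exists f, 0, g, 0; split; rewrite ?hcomp0l ?addr0 //; apply O1.
by rewrite (chiD.1 _ _ _ bXO) chiO addn0.
Qed.

(** Left adjoints preserve biproducts and cokernels, so characters pull back. *)
Lemma adjoint_character (p : C -> full_sub D) (chi : full_sub D -> nat) :
  is_left_adjoint p -> is_character chi -> is_character (chi \o p).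
Proof.
move=> [eta univ] chiD.
have map X Y (f : Hom X Y) : exists g : Hom (p X) (p Y),
    (g : Hom (sval (p X)) (sval (p Y))) \oc eta X = eta Y \oc f.
  by have [g [gf _]] := univ X (p Y) (eta Y \oc f); exists g.
have inj X (Y : full_sub D) (g h : Hom (p X) Y) :
    (g : Hom (sval (p X)) (sval Y)) \oc eta X =
    (h : Hom (sval (p X)) (sval Y)) \oc eta X -> g = h.
  move=> gh.
  have [t [_ tU]] := univ X Y ((h : Hom (sval (p X)) (sval Y)) \oc eta X).
  by rewrite -(tU g gh) -(tU h erefl).
split=> [X Y S [i1 [i2 [p1 [p2 [p11 p22 p12 p21 ip]]]]]|X Y Z f q fq].
  have [j1 j1E] := map _ _ i1; have [j2 j2E] := map _ _ i2.
  have [s1 s1E] := map _ _ p1; have [s2 s2E] := map _ _ p2.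
  apply: chiD.1; exists j1, j2, s1, s2; split; apply: inj.
  - by rewrite /= -hcompA j1E hcompA s1E -hcompA p11 hcomp_idr hcomp_idl.
  - by rewrite /= -hcompA j2E hcompA s2E -hcompA p22 hcomp_idr hcomp_idl.
  - by rewrite /= -hcompA j2E hcompA s1E -hcompA p12 hcomp0r hcomp0l.
  - by rewrite /= -hcompA j1E hcompA s2E -hcompA p21 hcomp0r hcomp0l.
  - rewrite /= hcompDl -!hcompA s1E s2E !hcompA j1E j2E -!hcompA -hcompDr ip.
    by rewrite hcomp_idr hcomp_idl.
have [pf pfE] := map _ _ f; have [pq pqE] := map _ _ q.
apply: (chiD.2 _ _ _ pf pq); apply: epi_factor_cokernel.
- move=> V u v uv; apply: inj; apply: (cokernel_epi fq).
  by rewrite -!hcompA -pqE !hcompA; congr (_ \oc _); apply: uv.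
- by apply: inj; rewrite /= -hcompA pfE hcompA pqE -hcompA fq.1 hcomp0r hcomp0l.
- move=> V h hpf.
  have : ((h : Hom (sval (p Y)) (sval V)) \oc eta Y) \oc f = 0.
    by rewrite -hcompA -pfE hcompA [X in X \oc _]hpf hcomp0l.
  move=> /(cokernel_fact fq) [u uq].
  have [g [gu _]] := univ Z V u.
  exists g; apply: inj.
  by rewrite /= -hcompA pqE hcompA gu uq.
Qed.

End Subcategory.

Section SpSub.
Context {k : comPzRingType} {C : linCat k} (abelC : abelian_cat C).
Context (lenC : length_cat C).
Implicit Types X Y Z W S : C.

(** A decomposition of the restriction of [chi] would pull back along the reflection
    to a decomposition of [chi]. *)
Lemma Sp_sub_cogenerated chi : Sp C chi -> Sp_sub (cogenerated abelC chi) chi.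
Proof.
move=> [chiC chi0 irr]; pose D := cogenerated abelC chi.
have [[O_D _] _] := cogenerated_subobject_closed abelC chiC.
have refl_ex X : exists Q : full_sub D, exists p : Hom X (sval Q),
    is_epi p /\ chi (sval Q) = chi X.
  have [Q [p [DQ pE chiQ]]] := cogenerated_quotient_exists abelC lenC chiC X.
  by exists (exist _ Q DQ), p.
pose p X := sval (cid (refl_ex X)).
pose eta X : Hom X (sval (p X)) := sval (cid (svalP (cid (refl_ex X)))).
have etaP X : is_epi (eta X) /\ chi (sval (p X)) = chi X.
  exact: svalP (cid (svalP (cid (refl_ex X)))).
have adj : is_left_adjoint p.
  exists eta => X Y f; have [etaE chiE] := etaP X.
  exact (cogenerated_reflection chiC etaE chiE f (svalP Y)).
pose chiD (Y : full_sub D) := chi (sval Y).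
have chiE : chi = chiD \o p by apply: funext => X; rewrite /= /chiD (etaP X).2.
exists p, chiD; split=> //; split.
- split=> [X Y S [i1 [i2 [p1 [p2 bS]]]]|X Y Z f q [qf0 univ]].
    by apply: chiC.1; exists i1, i2, p1, p2.
  (* the cokernel in D is a quotient of the cokernel in C *)
  have [Q [c fc]] := cokernel_exists abelC (f : Hom (sval X) (sval Y)).
  have [etaE chiQ] := etaP Q.
  have cf0 : (eta Q \oc c) \oc f = 0 by rewrite -hcompA fc.1 hcomp0r.
  have [t [tq _]] := univ (p Q) (eta Q \oc c : Hom (sval Y) (sval (p Q))) cf0.
  have tE : is_epi (t : Hom (sval Z) (sval (p Q))).
    move=> V u v uv; apply: (epi_comp etaE (cokernel_epi fc)).
    by rewrite -[eta Q \oc c]tq /= !hcompA uv.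
  apply: leq_trans (chiC.2 _ _ _ _ _ fc) _; rewrite leq_add2l -chiQ.
  exact: (character_epi_le abelC chiC tE).
- move=> chiD0; apply: chi0; rewrite chiE; apply: funext => X /=.
  by rewrite chiD0.
- move=> [chi1 [chi2 [C1 C2 n1 n2 chiD_sum]]]; apply: irr.
  have pull0 chi' : is_character chi' -> chi' <> zero_character (full_sub D) ->
      chi' \o p <> zero_character C.
    move=> C' n' e; apply: n'; apply: funext => Y.
    have : chi' (p (sval Y)) = 0%N by have := congr1 (fun h => h (sval Y)) e.
    (* an object of D is isomorphic to its own reflection *)
    have [etaE chiY] := etaP (sval Y).
    have [r [rE _]] :=
      cogenerated_reflection chiC etaE chiY (idm (sval Y)) (svalP Y).
    rewrite (@sub_character_iso _ _ D chi' Y (p (sval Y)) (eta (sval Y)) r) //.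
    by apply: etaE; rewrite /= -hcompA rE hcomp_idr hcomp_idl.
  exists (chi1 \o p), (chi2 \o p).
  split; try exact: adjoint_character; try exact: pull0.
  by apply: (etrans chiE); rewrite chiD_sum.
Qed.

(** If the reflection of [X] in [D] kills [u], then [X] and [Coker u] have the same
    reflection, so [u] has rank 0. Hence a cogenerated [X] embeds into its
    reflection. *)
Lemma cogenerated_minimal chi (D : set C) :
  is_character chi -> subobject_closed_subcat D -> Sp_sub D chi ->
  forall X, cogenerated abelC chi X -> D X.
Proof.
move=> chiC [[O_D _] subD] [p [chiD [[eta univ] [chiDC _ _] chiE]]] X DX.
apply: (subD _ _ (eta X)); last exact: svalP.
apply: mono_of_cancel0 => U u eta_u; apply: contrapT => u0.
have := DX _ _ u0.
(* X and its quotient by u have the same reflection *)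
have [Q [q uq]] := cokernel_exists abelC u; have qE := cokernel_epi uq.
have [t tq] := cokernel_fact uq eta_u.
have extends V (Y : full_sub D) (a : Hom V (sval Y)) :
    exists b : Hom (sval (p V)) (sval Y), b \oc eta V = a.
  by have [b [bE _]] := univ V Y a; exists b.
have [g gE] := extends X (p Q) (eta Q \oc q).
have [h hE] := extends Q (p X) t.
have uniq V (Y : full_sub D) (a b : Hom (sval (p V)) (sval Y)) :
    a \oc eta V = b \oc eta V -> a = b.
  move=> ab; have [c [_ cU]] := univ V Y (b \oc eta V).
  by rewrite -(cU a ab) -(cU b erefl).
have chiXQ : chi X = chi Q.
  rewrite chiE /=; apply: (@sub_character_iso _ _ D chiD _ _ g h) => //.
    by apply: uniq; rewrite /= -hcompA gE hcompA hE tq hcomp_idl.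
  by apply: uniq; apply: qE; rewrite /= -(hcompA g) hE -!hcompA tq gE hcomp_idl.
by have := rkE abelC chiC uq; lia.
Qed.

Lemma sub_eq_cogenerated chi psi : Sp C chi -> Sp C psi ->
  sub chi = sub psi -> cogenerated abelC chi = cogenerated abelC psi.
Proof.
suff incl chi' psi' : Sp C chi' -> Sp C psi' -> sub chi' = sub psi' ->
    forall X, cogenerated abelC psi' X -> cogenerated abelC chi' X.
  move=> chiI psiI e; apply: funext => X; apply: propext.
  by split; apply: incl.
move=> chiI psiI e; have [[chiC _ _] [psiC _ _]] := (chiI, psiI).
have closed := cogenerated_subobject_closed abelC chiC.
have : sub psi' psi' by move=> U [].
rewrite -e => /(_ (Sp_sub (cogenerated abelC chi'))) psi_in.
apply: (cogenerated_minimal psiC closed); apply: psi_in; split.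
  by exists (cogenerated abelC chi').
exact: Sp_sub_cogenerated.
Qed.

End SpSub.

(** * Characters with the same cogenerated objects *)

Section Separation.
Context {k : comPzRingType} {C : linCat k} (abelC : abelian_cat C).
Context (lenC : length_cat C).
Implicit Types X Y Z W S : C.

(** The subfunctor of [Hom X -] generated by [a] detects every non-zero subobject
    of [X]. *)
Definition faithful (chi : C -> nat) X (a : outgoing X) : Prop :=
  forall U (u : Hom U X), u <> 0 -> (0 < rk abelC chi (arrow a \oc u))%N.

(** Having rank 0 for [chi] means to vanish in the reflection of the target in the
    cogenerated objects. *)
Lemma cogenerated_rk0 chi psi : is_character chi -> is_character psi ->
  cogenerated abelC chi = cogenerated abelC psi ->
  forall X Y (f : Hom X Y), rk abelC psi f = 0%N -> rk abelC chi f = 0%N.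
Proof.
move=> chiC psiC eD X Y f psi_f.
have [Q [p [DQ pE chiQ]]] := cogenerated_quotient_exists abelC lenC chiC Y.
have pf : p \oc f = 0.
  apply: contrapT; rewrite eD in DQ => /DQ.
  by have := rk_postcomp_le abelC psiC p f; lia.
have [Z [q fq]] := cokernel_exists abelC f.
have [t tq] := cokernel_fact fq pf.
have tE : is_epi t by move=> V u v uv; apply: pE; rewrite -tq !hcompA uv.
by have := character_epi_le abelC chiC tE; have := rkE abelC chiC fq; lia.
Qed.

(** Faithfulness only asks which composites have rank 0. *)
Lemma faithful_transfer chi psi : is_character chi -> is_character psi ->
  cogenerated abelC chi = cogenerated abelC psi ->
  forall X (a : outgoing X), faithful chi a -> faithful psi a.
Proof.
move=> chiC psiC eD X a aF U u /aF; rewrite !lt0n; apply: contra => /eqP.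
by move=> /(cogenerated_rk0 chiC psiC eD) ->.
Qed.

(** By Frobenius' inequality, passing from [a u] to [c u] costs no more rank than
    passing from [a] to [c]. *)
Lemma faithful_same_rk chi X (a c : outgoing X) : is_character chi ->
  out_le c a -> out_rk abelC chi c = out_rk abelC chi a ->
  faithful chi a -> faithful chi c.
Proof.
move=> chiC [g cg]; rewrite /out_rk cg => e aF U u /aF; rewrite cg.
by have := rk_frobenius abelC chiC g (arrow a) u; rewrite e hcompA; lia.
Qed.

(** Take a faithful subfunctor of minimal rank. If the common part of the two
    characters vanishes, some smaller subfunctor has the same rank for one of the
    two characters and less for the other. It is faithful for the former, hence for
    both, against minimality. *)
Lemma cogenerated_inj chi psi : is_irreducible chi -> is_irreducible psi ->
  cogenerated abelC chi = cogenerated abelC psi -> chi = psi.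
Proof.
move=> chiI psiI eD; apply: contrapT => chi_psi.
have [[chiC chi0 _] [psiC _ _]] := (chiI, psiI).
have common0 := irreducible_common0 abelC chiC psiC chiI psiI chi_psi.
have [X [DX X0]] : exists X, cogenerated abelC chi X /\ (0 < chi X)%N.
  have [Y] : exists Y, chi Y <> 0%N.
    by apply/existsNP => chiY; apply: chi0; apply: funext.
  move=> /eqP; rewrite -lt0n => Y0.
  have [Q [p [DQ _ chiQ]]] := cogenerated_quotient_exists abelC lenC chiC Y.
  by exists Q; rewrite chiQ.
pose r (a : outgoing X) := (out_rk abelC chi a + out_rk abelC psi a)%N.
have no_faithful n a : r a = n -> ~ faithful chi a.
  elim/ltn_ind: n a => n IH a ra aF.
  have aF' := faithful_transfer chiC psiC eD aF.
  have [latX valchi valpsi] := And3 (out_lattice abelC X)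
    (out_rk_valuation abelC X chiC) (out_rk_valuation abelC X psiC).
  have := common_cost (out_rk abelC chi (X := X)) (out_rk abelC psi (X := X))
    (out_le_top (out_bot X)).
  move: (common0 X); rewrite /common_character /out_common => ->.
  move=> /(chain_meet latX valchi valpsi (out_le_top a) (out_zero_le X a)).
  move=> [m1 [m2 [_ abot m12]]]; have m20 : m2 = 0%N by move: m12; lia.
  have [[bot_a _]|[c [ca lt_c eq_c]]] :=
    chain_cost0_separates latX valchi valpsi abot m20.
    have idX0 : idm X <> 0.
      by move=> e; move: X0; rewrite -(rk_idm abelC chiC) e (rk0 abelC chiC).
    have := aF _ _ idX0; rewrite hcomp_idr; move: bot_a.
    by rewrite /out_rk /= (rk0 abelC chiC) => <-.
  have rc : (r c < n)%N.
    have := out_rk_mono abelC chiC ca; have := out_rk_mono abelC psiC ca.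
    by rewrite -ra /r; move: lt_c; lia.
  apply: (IH _ rc c erefl); case/orP: eq_c => /eqP e.
    exact: faithful_same_rk ca e aF.
  apply: (faithful_transfer psiC chiC (esym eD)).
  exact: faithful_same_rk ca e aF'.
apply: (no_faithful _ (out_top X) erefl) => U u /DX.
by rewrite /= hcomp_idl.
Qed.

End Separation.

Theorem theorem4p2 (k : comPzRingType) (C : linCat k)
    (abelC : abelian_cat C) (lenC : length_cat C) (finC : hom_finite C)
    (chi psi : C -> nat) (chi_irr : Sp C chi) (psi_irr : Sp C psi) :
  sub chi = sub psi <-> chi = psi.
Proof.
split=> [e|->//]; apply: (cogenerated_inj (abelC := abelC) lenC chi_irr psi_irr).
exact: sub_eq_cogenerated.
Qed.
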